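(* Let $G$ be a connected non-complete $k$-regular graph on $n$ vertices that is co-edge-regular with parameter $\mu$. Then $G$ has at most $4$ distinct eigenvalues if and only if there exist real numbers $\alpha,\beta,\gamma$ such that $G$ is $(\alpha,\beta)$-weakly edge-regular and $(\mu,\gamma)$-strongly co-edge-regular. Furthermore, if $G$ has exactly $4$ distinct eigenvalues $k>\theta_1>\theta_2>\theta_3$, then $$\alpha-\mu=\theta_1+\theta_2+\theta_3,\qquad \mu(\alpha-1)+k-\beta-\gamma=-(\theta_1\theta_2+\theta_1\theta_3+\theta_2\theta_3),$$ $$\mu(k-\alpha)+\gamma=\frac{(k-\theta_1)(k-\theta_2)(k-\theta_3)}{n}.$$
   Context: Graphs are finite, simple, undirected; eigenvalues are those of the adjacency matrix. $N(x)$ is the set of neighbours of $x$. For adjacent vertices $x,y$, $\lambda(x,y)$ denotes the number of common neighbours of $x$ and $y$. A regular graph is co-edge-regular with parameter $\mu$ if any two distinct non-adjacent vertices have exactly $\mu$ common neighbours. A co-edge-regular graph with parameter $\mu$ is $(\mu,\gamma)$-strongly co-edge-regular if every pair of distinct non-adjacent vertices $x,y$ satisfies $\sum_{z\in N(x)\cap N(y)}\lambda(x,z)=\gamma$. A regular graph is $(\alpha,\beta)$-weakly edge-regular if every pair of adjacent vertices $x,y$ satisfies $\alpha\,\lambda(x,y)=\sum_{z\in N(x)\cap N(y)}\lambda(x,z)+\beta$. *)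

(* Defs.v *)
From mathcomp Require Import all_boot all_order all_algebra.
From mathcomp Require Import reals.

Set Implicit Arguments.
Unset Strict Implicit.
Unset Printing Implicit Defensive.

Import Order.TTheory GRing.Theory Num.Theory.
Local Open Scope ring_scope.

(* A finite simple graph is a symmetric irreflexive relation [e] on a finite
   type [V]; symmetry and irreflexivity are hypotheses of the theorem. *)

Definition nbrs (V : finType) (e : rel V) (x : V) : {set V} :=
  [set y | e x y].

Definition common_nbrs (V : finType) (e : rel V) (x y : V) : {set V} :=
  nbrs e x :&: nbrs e y.

(* lambda(x, y), meant for adjacent x and y. *)
Definition lambda_cn (V : finType) (e : rel V) (x y : V) : nat :=
  #|common_nbrs e x y|.

Definition lambda_sum (V : finType) (e : rel V) (x y : V) : nat :=
  (\sum_(z in common_nbrs e x y) lambda_cn e x z)%N.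

Definition graph_connected (V : finType) (e : rel V) : Prop :=
  forall x y : V, connect e x y.

Definition graph_complete (V : finType) (e : rel V) : Prop :=
  forall x y : V, x != y -> e x y.

Definition regular_of_degree (V : finType) (e : rel V) (k : nat) : Prop :=
  forall x : V, #|nbrs e x| = k.

Definition graph_regular (V : finType) (e : rel V) : Prop :=
  exists k : nat, regular_of_degree e k.

Definition co_edge_regular (V : finType) (e : rel V) (mu : nat) : Prop :=
  graph_regular e /\
  forall x y : V, x != y -> ~~ e x y -> #|common_nbrs e x y| = mu.

Definition strongly_co_edge_regular (R : realType) (V : finType) (e : rel V)
    (mu : nat) (gamma : R) : Prop :=
  co_edge_regular e mu /\
  forall x y : V, x != y -> ~~ e x y -> (lambda_sum e x y)%:R = gamma.

Definition weakly_edge_regular (R : realType) (V : finType) (e : rel V)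
    (alpha beta : R) : Prop :=
  graph_regular e /\
  forall x y : V, e x y ->
    alpha * (lambda_cn e x y)%:R = (lambda_sum e x y)%:R + beta.

Definition adj_mx (R : realType) (V : finType) (e : rel V) : 'M[R]_#|V| :=
  \matrix_(i, j) (e (enum_val i) (enum_val j))%:R.

(* [s] lists the distinct real eigenvalues of the adjacency matrix, without
   repetition; the matrix being symmetric, these are all its eigenvalues. *)
Definition distinct_eigenvalues (R : realType) (V : finType) (e : rel V)
    (s : seq R) : Prop :=
  uniq s /\ forall a : R, (a \in s) = eigenvalue (adj_mx R e) a.

(* Main.v *)
(** Write [A] for the adjacency matrix and [J] for the all-one matrix.  Both
    sides of the equivalence say that [A^3 = a A^2 + b A + c I + d J] for some
    [a], [b], [c], [d].  Off the diagonal this is a matter of counting walks of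
    length 3, since [A^3 x y] is [lambda_sum x y] plus a contribution of the
    neighbours of [y] outside [N(x)] that co-edge-regularity determines; the
    diagonal takes care of itself because [A], [A^2] and [J] have constant row
    sums.  On the spectral side, eigenvectors for [theta <> k] are orthogonal to
    the all-one vector, so such [theta] are roots of the cubic
    [X^3 - a X^2 - b X - c]; conversely, if a monic cubic [q] vanishes at all the
    eigenvalues other than [k], then [(A - k) q(A) = 0] as [A] is diagonalizable,
    and [q(A)] is a multiple of [J] by connectedness. *)
Require Import Defs.
From mathcomp Require Import all_boot all_order all_algebra.
From mathcomp Require Import reals.
From mathcomp Require Import spectral complex ring lra.

Set Implicit Arguments.
Unset Strict Implicit.
Unset Printing Implicit Defensive.

Import Order.TTheory GRing.Theory Num.Theory.
Local Open Scope ring_scope.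

(** * Diagonalization of real symmetric matrices *)

(** Over [R[i]] the matrix is Hermitian, so it is unitarily diagonalizable with real eigenvalues.
    Similarity of two real matrices descends from [R[i]] to [R], which makes [P] real; its rows are
    eigenvectors. *)
Lemma symmetric_diagonalizable (R : rcfType) (m : nat) (A : 'M[R]_m) :
  A^T = A ->
  exists (P : 'M_m) (d : 'rV_m), P \in unitmx /\ P *m A = diag_mx d *m P.
Proof.
move=> symA; pose toC := map_mx (real_complex R).
have real_toC p q (B : 'M_(p, q)) : map_mx (real_complex R) B \is a realmx.
  by apply/mxOverP => i j; rewrite mxE; apply/complex_realP; exists (B i j).
have realE p q (B : 'M[R[i]]_(p, q)) : B \is a realmx ->
    B = map_mx (real_complex R) (map_mx (@complex.Re R) B).
  by move=> /mxOverP realB; apply/matrixP => i j; rewrite !mxE RRe_real.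
have hermA : toC _ _ A \is hermsymmx.
  apply/is_hermitianmxP; rewrite expr0 scale1r; apply/matrixP => i j.
  rewrite !mxE -[in LHS]symA mxE.
  by rewrite conj_Creal //; apply/complex_realP; exists (A j i).
have /orthomx_spectralP /= specA := hermitian_normalmx hermA.
pose d := map_mx (@complex.Re R) (spectral_diag (toC _ _ A)).
have diag_real : spectral_diag (toC _ _ A) = toC _ _ d.
  exact: realE (hermitian_spectral_diag_real hermA).
have sim : similar_in unitmx (toC _ _ A) (toC _ _ (diag_mx d)).
  exists (spectralmx (toC _ _ A)); first exact: spectral_unit.
  apply/similarP; first exact: spectral_unit.
  by rewrite {2}specA !mulmxA mulmxV ?spectral_unit // mul1mx diag_real /toC map_diag_mx.
have [P /andP [/realE PE unitP]] := real_similar sim (real_toC _ _ _) (real_toC _ _ _).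
move/(similarP unitP); move: unitP; rewrite PE map_unitmx => unitQ.
by rewrite -!map_mxM => /map_mx_inj PA; exists (map_mx (@complex.Re R) P), d.
Qed.

Lemma eigenvalue_diagonalized (F : fieldType) (m : nat) (A P : 'M[F]_m)
    (d : 'rV_m) (a : F) : P \in unitmx -> P *m A = diag_mx d *m P ->
  eigenvalue A a = [exists i, d 0 i == a].
Proof.
move=> unitP PA; apply/eigenvalueP/existsP => [[v vA v0] | [i /eqP <-]].
  have w0 : v *m invmx P != 0.
    by apply: contraNneq v0 => w0; rewrite -(mulmxKV unitP v) w0 mul0mx.
  have wd : v *m invmx P *m diag_mx d = a *: (v *m invmx P).
    rewrite -(mulmxK unitP (_ *m diag_mx d)) -[_ *m _ *m P]mulmxA -PA.
    by rewrite mulmxA mulmxKV // vA scalemxAl.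
  (* Any nonzero coordinate of [v *m invmx P] singles out an index with [d 0 i = a]. *)
  have [i wi] := rV0Pn _ w0; exists i.
  move: (v *m invmx P) wd wi => w /rowP /(_ i) + wi.
  by rewrite mul_mx_diag !mxE mulrC => /(mulIf wi) ->.
exists (row i P); first by rewrite -row_mul PA mul_diag_mx; apply/rowP => j; rewrite !mxE.
apply/eqP => Pi0.
have /rowP /(_ i) : delta_mx 0 i = 0 :> 'rV[F]_m.
  by rewrite -(mulmxK unitP (delta_mx 0 i)) -rowE Pi0 mul0mx.
by rewrite !mxE !eqxx => /eqP; rewrite oner_eq0.
Qed.

(** The rows of [P] form a basis of left eigenvectors, so [P *m X = 0]. This lets matrix identities
    be checked on eigenvectors. *)
Lemma symmetric_mulmx_eq0 (R : rcfType) (m : nat) (A X : 'M[R]_m) : A^T = A ->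
  (forall (v : 'rV_m) t, v *m A = t *: v -> v != 0 -> v *m X = 0) -> X = 0.
Proof.
move=> /symmetric_diagonalizable [P [d [unitP PA]]] vX0.
rewrite -(mulKmx unitP X) [P *m X](_ : _ = 0) ?mulmx0 //.
apply/row_matrixP => i; rewrite row_mul row0.
have [-> | Pi0] := eqVneq (row i P) 0; first by rewrite mul0mx.
apply: (vX0 _ (d 0 i)) => //.
by rewrite -row_mul PA mul_diag_mx; apply/rowP => j; rewrite !mxE.
Qed.

Lemma eigenvector_cubic (F : comNzRingType) (m : nat) (A : 'M[F]_m) (v : 'rV_m)
    (a b c t : F) : v *m A = t *: v ->
  v *m (A *m A *m A - a *: (A *m A) - b *: A - c%:M)
    = (t ^+ 3 - a * t ^+ 2 - b * t - c) *: v.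
Proof.
move=> vA.
have vA2 : v *m (A *m A) = t ^+ 2 *: v by rewrite mulmxA vA -scalemxAl vA scalerA.
have vA3 : v *m (A *m A *m A) = t ^+ 3 *: v.
  by rewrite mulmxA vA2 -scalemxAl vA scalerA -exprSr.
by rewrite !mulmxBr -!scalemxAr vA3 vA2 vA mul_mx_scalar !scalerA -!scalerBl.
Qed.

(** * Cubics and their roots *)

Lemma cubic_roots_seq (F : comNzRingType) (s : seq F) : (size s <= 3)%N ->
  exists a b c : F, {in s, forall t, t ^+ 3 = a * t ^+ 2 + b * t + c}.
Proof.
(* When [s] is shorter, the default [0] only adds roots to [(X - x)(X - y)(X - z)]. *)
move=> size_s; set x := s`_0; set y := s`_1; set z := s`_2.
exists (x + y + z), (- (x * y + x * z + y * z)), (x * y * z) => t ts.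
suff : (t - x) * (t - y) * (t - z) = 0.
  by move=> h; apply/eqP; rewrite -subr_eq0 -h; apply/eqP; ring.
have := nth_index 0 ts; have := ts; rewrite -index_mem => /leq_trans/(_ size_s).
rewrite /x /y /z; case: (index t s) => [|[|[|//]]] _ ->; ring.
Qed.

Lemma size_cubic (F : nzRingType) (a b c : F) :
  size ('X^3 - a *: 'X^2 - b *: 'X - c%:P) = 4.
Proof.
have size_lt : (size (- (a *: 'X^2) - b *: 'X - c%:P)%R < 4)%N.
  apply/leq_sizeP => j; case: j => [|[|[|j]]] // _.
  by rewrite !(coefB, coefN, coefZ, coefXn, coefX, coefC) /= !(mulr0, oppr0, addr0).
by rewrite -!addrA size_polyDl size_polyXn // addrA.
Qed.

(** Subtracting two equations and dividing by the difference of the roots eliminates [c]; repeating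
    this eliminates [b] and yields [a]. Back substitution gives [b] and [c]. *)
Lemma cubic_vieta (F : fieldType) (a b c t1 t2 t3 : F) :
  t1 ^+ 3 = a * t1 ^+ 2 + b * t1 + c ->
  t2 ^+ 3 = a * t2 ^+ 2 + b * t2 + c ->
  t3 ^+ 3 = a * t3 ^+ 2 + b * t3 + c ->
  t1 != t2 -> t1 != t3 -> t2 != t3 ->
  [/\ a = t1 + t2 + t3, b = - (t1 * t2 + t1 * t3 + t2 * t3)
    & c = t1 * t2 * t3].
Proof.
have divided_difference x y : x ^+ 3 = a * x ^+ 2 + b * x + c ->
    y ^+ 3 = a * y ^+ 2 + b * y + c -> x != y ->
    x ^+ 2 + x * y + y ^+ 2 = a * (x + y) + b.
  move=> hx hy; rewrite -subr_eq0 => /mulfI; apply.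
  have -> : (x - y) * (x ^+ 2 + x * y + y ^+ 2) = x ^+ 3 - y ^+ 3 by ring.
  by rewrite hx hy; ring.
move=> h1 h2 h3 n12 n13 n23.
have h12 := divided_difference _ _ h1 h2 n12.
have h13 := divided_difference _ _ h1 h3 n13.
have aE : a = t1 + t2 + t3.
  move: n23; rewrite -subr_eq0 => /mulfI; apply.
  have -> : (t2 - t3) * a = (a * (t1 + t2) + b) - (a * (t1 + t3) + b) by ring.
  by rewrite -h12 -h13; ring.
have bE : b = - (t1 * t2 + t1 * t3 + t2 * t3).
  by rewrite -(addKr (a * (t1 + t2)) b) -h12 aE; ring.
by split=> //; rewrite -(addKr (a * t1 ^+ 2 + b * t1) c) -h1 aE bE; ring.
Qed.

(** * Entries, row sums and eigenvectors of the adjacency matrix *)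

Section AdjacencyMatrix.

Variables (R : realType) (V : finType) (e : rel V) (k mu : nat).
Hypotheses (e_sym : symmetric e) (e_irr : irreflexive e).
Hypotheses (e_reg : regular_of_degree e k).

Local Notation A := (adj_mx R e).
Local Notation "'x_ i" := (enum_val i : V) (at level 8, i at level 2).
Local Notation one := (const_mx 1 : 'cV[R]_#|V|).

Let sum_ord (F : V -> R) : \sum_(i < #|V|) F 'x_i = \sum_x F x.
Proof. by rewrite -(big_enum_val F). Qed.

Lemma adj_mxE i j : A i j = (e 'x_i 'x_j)%:R.
Proof. by rewrite mxE. Qed.

Lemma adj_mx_sym : A^T = A.
Proof. by apply/matrixP => i j; rewrite !mxE e_sym. Qed.

Lemma adj_mx_sqrE i j : (A *m A) i j = #|common_nbrs e 'x_i 'x_j|%:R.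
Proof.
rewrite mxE; under eq_bigr do rewrite !adj_mxE.
rewrite (sum_ord (fun z => (e 'x_i z)%:R * (e z 'x_j)%:R)) -sum1_card natr_sum.
rewrite [RHS]big_mkcond; apply: eq_bigr => z _.
by rewrite !inE (e_sym 'x_j); do 2!case: (e _ _); rewrite ?mulr0 ?mul0r ?mulr1.
Qed.


Lemma card_common_nbrsxx x : #|common_nbrs e x x| = k.
Proof. by rewrite /common_nbrs setIid e_reg. Qed.

Lemma adj_mx_one : A *m one = k%:R *: one.
Proof.
apply/colP => i; rewrite !mxE; under eq_bigr do rewrite !mxE mulr1.
rewrite (sum_ord (fun z => (e 'x_i z)%:R)) mulr1 -(e_reg 'x_i) -sum1_card natr_sum.
by rewrite [RHS]big_mkcond; apply: eq_bigr => z _; rewrite inE; case: (e _ _).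
Qed.

Lemma mx_one_rowsum m (M : 'M[R]_(m, #|V|)) i : (M *m one) i 0 = \sum_j M i j.
Proof. by rewrite mxE; apply: eq_bigr => j _; rewrite mxE mulr1. Qed.

Lemma const_mx_one (d : R) : (const_mx d : 'M_#|V|) *m one = (d * #|V|%:R) *: one.
Proof.
apply/colP => i; rewrite mx_one_rowsum; under eq_bigr do rewrite mxE.
by rewrite sumr_const card_ord !mxE mulr1 mulr_natr.
Qed.

Lemma eigenvalue_degree : (0 < #|V|)%N -> eigenvalue A k%:R.
Proof.
move=> V_gt0; apply/eigenvalueP; exists one^T.
  by rewrite -{1}adj_mx_sym -trmx_mul adj_mx_one linearZ.
apply/eqP => /matrixP /(_ 0 (Ordinal V_gt0)); rewrite !mxE => /eqP.
by rewrite oner_eq0.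
Qed.

Lemma eigenvalue_cubic (a b c d theta : R) :
  A *m A *m A = a *: (A *m A) + b *: A + c%:M + const_mx d ->
  eigenvalue A theta -> theta != k%:R ->
  theta ^+ 3 = a * theta ^+ 2 + b * theta + c.
Proof.
move=> A3 /eigenvalueP [v vA v0] thetaNk.
have v1 : v *m one = 0.
  (* The two sides are evaluated differently, as [theta] and as [k] times [v *m one]. *)
  have /eqP : v *m A *m one = v *m A *m one by [].
  rewrite {1}vA -mulmxA adj_mx_one -scalemxAl -scalemxAr -subr_eq0 -scalerBl.
  by rewrite scaler_eq0 subr_eq0 (negPf thetaNk) => /eqP.
have vJ : v *m (const_mx d : 'M_#|V|) = 0.
  apply/rowP => j; rewrite !mxE; under eq_bigr do rewrite mxE.
  by rewrite -mulr_suml -mx_one_rowsum v1 mxE mul0r.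
have := eigenvector_cubic a b c vA; rewrite A3.
rewrite [X in v *m X](_ : _ = const_mx d) ?vJ.
  move/eqP; rewrite eq_sym scaler_eq0 (negPf v0) orbF => /eqP h.
  by apply/eqP; rewrite -subr_eq0 -h; apply/eqP; ring.
(* Abstracting the powers of [A] keeps [mxE] from unfolding products into sums. *)
move: A (A *m A) => A1 A2.
by apply/matrixP => i j; rewrite !mxE; ring.
Qed.

Lemma adj_mx_sqr_one : A *m A *m one = k%:R ^+ 2 *: one.
Proof. by rewrite -mulmxA adj_mx_one -scalemxAr adj_mx_one scalerA. Qed.

Lemma adj_mx_cube_one : A *m A *m A *m one = k%:R ^+ 3 *: one.
Proof. by rewrite -mulmxA adj_mx_one -scalemxAr adj_mx_sqr_one scalerA. Qed.

(** Both sides are applied to the all-one vector. This expresses [d * #|V|] as the value at [k] of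
    the cubic, the source of the product formula in the theorem. *)
Lemma cubic_rowsum (a b c d : R) : (0 < #|V|)%N ->
  A *m A *m A = a *: (A *m A) + b *: A + c%:M + const_mx d ->
  k%:R ^+ 3 = a * k%:R ^+ 2 + b * k%:R + c + d * #|V|%:R.
Proof.
move=> V_gt0 /(congr1 (fun M => M *m one)).
rewrite !mulmxDl const_mx_one mul_scalar_mx -!scalemxAl.
rewrite adj_mx_cube_one adj_mx_sqr_one adj_mx_one !scalerA -!scalerDl.
by move=> /matrixP /(_ (Ordinal V_gt0) 0); rewrite !mxE !mulr1.
Qed.

(* [c] is the common row sum of [A^3 - a A^2 - b A - d J]. *)
Lemma cubic_offdiag (a b d : R)
    (c := k%:R ^+ 3 - a * k%:R ^+ 2 - b * k%:R - d * #|V|%:R) :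
  (forall i j, i != j -> (A *m A *m A) i j = a * (A *m A) i j + b * A i j + d) ->
  A *m A *m A = a *: (A *m A) + b *: A + c%:M + const_mx d.
Proof.
move=> off; pose M := A *m A *m A - a *: (A *m A) - b *: A - const_mx d.
have offM i j : i != j -> M i j = 0.
  move=> ij; have := off i j ij; rewrite /M.
  move: A (A *m A) (A *m A *m A) => A1 A2 A3 A3E.
  by rewrite !mxE A3E; ring.
suff -> : c%:M = M.
  rewrite /M; move: A (A *m A) (A *m A *m A) => A1 A2 A3.
  by apply/matrixP => i j; rewrite !mxE; ring.
have M1 : M *m one = c *: one.
  rewrite !mulmxBl const_mx_one -!scalemxAl.
  by rewrite adj_mx_cube_one adj_mx_sqr_one adj_mx_one !scalerA -!scalerBl.
apply/matrixP => i j; rewrite mxE; case: eqVneq => [<-{j}|/offM-> //].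
(* As [M] is diagonal, each row sum is the diagonal entry. *)
have := mx_one_rowsum M i; rewrite M1 (bigD1 i) //= big1 => [|j ji].
  by rewrite !mxE mulr1 addr0 => ->.
by rewrite offM // eq_sym.
Qed.

(** Connectedness makes [k] a simple eigenvalue; this is applied to the columns of a cubic in
    [A]. *)
Lemma eigenvector_const (f : 'cV[R]_#|V|) : graph_connected e ->
  A *m f = k%:R *: f -> forall i j, f i 0 = f j 0.
Proof.
move=> conn Af; pose g x := f (enum_rank x) 0.
have sum_g x : \sum_(y in nbrs e x) g y = k%:R * g x.
  move/matrixP/(_ (enum_rank x) 0): Af; rewrite !mxE => <-.
  rewrite big_mkcond -(sum_ord (fun y => if y \in nbrs e x then g y else 0)).
  apply: eq_bigr => i _; rewrite mxE enum_rankK inE /g enum_valK.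
  by case: (e _ _); rewrite ?mul1r ?mul0r.
suff g_const x y : g x = g y.
  by move=> i j; have := g_const 'x_i 'x_j; rewrite /g !enum_valK.
pose m := [arg max_(z > x) g z]%O.
have g_le z : g z <= g m by rewrite /m; case: arg_maxP => // t _; apply.
(* Maximum principle: the maximum spreads along the edges. *)
have spread s t : e s t -> g s = g m -> g t = g m.
  move=> st gs; apply/eqP; rewrite eq_le g_le /= leNgt; apply/negP => lt_t.
  suff : \sum_(y in nbrs e s) g y < \sum_(y in nbrs e s) g m.
    by rewrite sumr_const e_reg sum_g gs mulr_natl ltxx.
  rewrite (bigD1 t) ?inE //= [X in _ < X](bigD1 t) ?inE //=.
  by apply: ltr_leD => //; apply: ler_sum.
have cl : closed e [pred z | g z == g m].
  move=> s t st; apply/eqP/eqP => [|gt]; first exact: spread.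
  by apply: (spread t) => //; rewrite e_sym.
have gm z : g z = g m.
  by apply/eqP; have := closed_connect cl (conn m z); rewrite !inE eqxx => <-.
by rewrite gm [RHS]gm.
Qed.

(** * Walks of length three and the cubic relation *)

(** Walks from [x] to [y] are sorted by their last inner vertex [z]. Those with [z] in [N(x)] give
    [lambda_sum]; any other [z] contributes [mu], except that [z = x], possible when [x] and [y] are
    adjacent, contributes [k]. *)
Lemma adj_mx_cubeE i j : co_edge_regular e mu ->
  (A *m A *m A) i j = (lambda_sum e 'x_i 'x_j)%:R
     + (e 'x_i 'x_j)%:R * (k%:R - mu%:R)
     + mu%:R * (k%:R - (A *m A) i j) :> R.
Proof.
move=> [_ coreg]; rewrite adj_mx_sqrE mxE.
set x := 'x_i; set y := 'x_j.
under eq_bigr do rewrite adj_mx_sqrE adj_mxE.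
rewrite (sum_ord (fun z => #|common_nbrs e x z|%:R * (e z y)%:R)).
have -> : \sum_z #|common_nbrs e x z|%:R * (e z y)%:R
        = \sum_(z in nbrs e y) #|common_nbrs e x z|%:R :> R.
  rewrite [RHS]big_mkcond; apply: eq_bigr => z _.
  by rewrite inE e_sym; case: (e _ _); rewrite ?mulr1 ?mulr0.
rewrite (big_setID (nbrs e x)) /= setIC natr_sum -addrA; congr (_ + _).
have card_yx : (k = #|common_nbrs e x y| + #|nbrs e y :\: nbrs e x|)%N.
  by rewrite -(e_reg y) -(cardsID (nbrs e x)) setIC.
have -> : \sum_(z in nbrs e y :\: nbrs e x) #|common_nbrs e x z|%:R
    = \sum_(z in nbrs e y :\: nbrs e x) (mu%:R + (z == x)%:R * (k%:R - mu%:R)) :> R.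
  apply: eq_bigr => z; rewrite !inE => /andP [xz yz].
  case: eqVneq => [->|zx]; first by rewrite card_common_nbrsxx mul1r addrC subrK.
  by rewrite coreg // 1?eq_sym // mul0r addr0.
have -> : \sum_(z in nbrs e y :\: nbrs e x) (mu%:R + (z == x)%:R * (k%:R - mu%:R))
    = #|nbrs e y :\: nbrs e x|%:R * mu%:R + (e x y)%:R * (k%:R - mu%:R) :> R.
  rewrite big_split /= sumr_const mulr_natl -mulr_suml; congr (_ + _ * _).
  case: (boolP (e x y)) => exy.
    rewrite (bigD1 x) /= ?inE ?e_irr 1?e_sym ?exy // eqxx big1 ?addr0 // => z.
    by case/andP => _ /negPf ->.
  rewrite big1 // => z; rewrite !inE e_sym; case: eqVneq => // -> /andP [_].
  by rewrite e_sym (negPf exy).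
have kE : k%:R = #|common_nbrs e x y|%:R + #|nbrs e y :\: nbrs e x|%:R :> R.
  by rewrite [in LHS]card_yx natrD.
by rewrite kE; ring.
Qed.

Lemma exists_distinct_eigenvalues : exists s : seq R, distinct_eigenvalues e s.
Proof.
have [P [d [unitP PA]]] := symmetric_diagonalizable adj_mx_sym.
exists (undup [seq d 0 i | i : 'I_#|V|]); split=> [|a]; first exact: undup_uniq.
rewrite (eigenvalue_diagonalized a unitP PA) mem_undup.
by apply/imageP/existsP => [[i _ ->]|[i /eqP <-]]; exists i.
Qed.

(** With [M] the cubic in [A], the columns of [M] lie in the [k]-eigenspace, hence are constant;
    symmetry makes the rows constant too. *)
Lemma adj_mx_cubic (a b c : R) : (0 < #|V|)%N -> graph_connected e ->
  (forall t, eigenvalue A t -> t != k%:R -> t ^+ 3 = a * t ^+ 2 + b * t + c) ->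
  exists d, A *m A *m A = a *: (A *m A) + b *: A + c%:M + const_mx d.
Proof.
move=> V_gt0 conn roots; pose M := A *m A *m A - a *: (A *m A) - b *: A - c%:M.
have AM : A *m M = k%:R *: M.
  apply/eqP; rewrite -subr_eq0; apply/eqP.
  apply: (symmetric_mulmx_eq0 adj_mx_sym) => v t vA v0.
  have eig : eigenvalue A t by apply/eigenvalueP; exists v.
  rewrite mulmxBr mulmxA vA -scalemxAl -scalemxAr -scalerBl.
  rewrite (eigenvector_cubic _ _ _ vA) scalerA.
  (* At [t = k] the factor [t - k] vanishes; elsewhere the cubic does. *)
  have [-> | tk] := eqVneq t k%:R; first by rewrite subrr mul0r scale0r.
  by rewrite [X in _ * X](_ : _ = 0) ?mulr0 ?scale0r // roots //; ring.
have col_const i i' j : M i j = M i' j.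
  suff colj : A *m col j M = k%:R *: col j M.
    have := eigenvector_const conn colj i i'.
    by rewrite [col j M i 0]mxE [col j M i' 0]mxE => ->.
  by rewrite colE mulmxA AM scalemxAl.
have symM : M^T = M.
  rewrite /M !linearB /= !linearZ /= !trmx_mul tr_scalar_mx adj_mx_sym.
  by rewrite mulmxA.
pose o := Ordinal V_gt0; exists (M o o).
have -> : const_mx (M o o) = M.
  apply/matrixP => i j; rewrite mxE (col_const i o).
  by rewrite -[in RHS]symM [RHS]mxE (col_const j o).
rewrite /M; move: A (A *m A) (A *m A *m A) => A1 A2 A3.
by apply/matrixP => i j; rewrite !mxE; ring.
Qed.

(** The coefficients come from matching entries in the walk count: [a] multiplies the number of
    common neighbours, non-adjacent pairs fix [d], adjacent pairs fix [b + d], and row sums force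
    [c]. *)
Lemma weakly_strongly_regular_cubic (alpha beta gamma : R)
    (a := alpha - mu%:R)
    (b := mu%:R * (alpha - 1) + k%:R - beta - gamma)
    (d := mu%:R * (k%:R - alpha) + gamma)
    (c := k%:R ^+ 3 - a * k%:R ^+ 2 - b * k%:R - d * #|V|%:R) :
  weakly_edge_regular e alpha beta -> strongly_co_edge_regular e mu gamma ->
  A *m A *m A = a *: (A *m A) + b *: A + c%:M + const_mx d.
Proof.
move=> [_ wer] [coreg scer]; apply: cubic_offdiag => i j ij.
rewrite adj_mx_cubeE // adj_mxE.
have xy : 'x_i != 'x_j by rewrite (inj_eq enum_val_inj).
case: (boolP (e 'x_i 'x_j)) => exy.
  have <- : alpha * (A *m A) i j - beta = (lambda_sum e 'x_i 'x_j)%:R.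
    by rewrite adj_mx_sqrE wer // addrK.
  by rewrite /= /a /b /d; ring.
have -> : (A *m A) i j = mu%:R by rewrite adj_mx_sqrE coreg.2.
by rewrite scer //= /a /d; ring.
Qed.

(** The off-diagonal entries of the relation are solved for [lambda_sum], separately for adjacent
    and non-adjacent pairs. *)
Lemma cubic_weakly_strongly_regular (a b c d : R) : co_edge_regular e mu ->
  A *m A *m A = a *: (A *m A) + b *: A + c%:M + const_mx d ->
  weakly_edge_regular e (a + mu%:R) (k%:R - mu%:R + mu%:R * k%:R - b - d) /\
  strongly_co_edge_regular e mu (a * mu%:R + d - mu%:R * (k%:R - mu%:R)).
Proof.
move=> coreg A3.
have key x y : x != y -> (lambda_sum e x y)%:R + (e x y)%:R * (k%:R - mu%:R)
    + mu%:R * (k%:R - #|common_nbrs e x y|%:R)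
  = a * #|common_nbrs e x y|%:R + b * (e x y)%:R + d :> R.
  rewrite -(inj_eq enum_rank_inj) => ij.
  have := adj_mx_cubeE (enum_rank x) (enum_rank y) coreg.
  have := adj_mx_sqrE (enum_rank x) (enum_rank y).
  have := adj_mxE (enum_rank x) (enum_rank y).
  rewrite !enum_rankK => <- <- <-; rewrite A3.
  move: A (A *m A) => A1 A2.
  by rewrite !mxE (negPf ij) mulr0n addr0.
split; split=> //; first exact: coreg.1.
  move=> x y exy; have xy : x != y by apply: contraTneq exy => ->; rewrite e_irr.
  by have := key x y xy; rewrite exy /lambda_cn /= => h; lra.
by move=> x y xy exy; have := key x y xy; rewrite (negPf exy) coreg.2 //= => h; lra.
Qed.

End AdjacencyMatrix.

Theorem theorem3p2 (R : realType) (V : finType) (e : rel V) (n k mu : nat)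
    (e_sym : symmetric e) (e_irr : irreflexive e)
    (card_V : #|V| = n)
    (e_conn : graph_connected e) (e_ncomp : ~ graph_complete e)
    (e_reg : regular_of_degree e k) (e_coreg : co_edge_regular e mu) :
  ((exists2 s : seq R, distinct_eigenvalues e s & (size s <= 4)%N) <->
   (exists alpha beta gamma : R,
      weakly_edge_regular e alpha beta /\
      strongly_co_edge_regular e mu gamma)) /\
  (forall alpha beta gamma theta1 theta2 theta3 : R,
     weakly_edge_regular e alpha beta ->
     strongly_co_edge_regular e mu gamma ->
     distinct_eigenvalues e [:: k%:R; theta1; theta2; theta3] ->
     theta1 < k%:R -> theta2 < theta1 -> theta3 < theta2 ->
     [/\ alpha - mu%:R = theta1 + theta2 + theta3,
         mu%:R * (alpha - 1) + k%:R - beta - gamma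
           = - (theta1 * theta2 + theta1 * theta3 + theta2 * theta3)
       & mu%:R * (k%:R - alpha) + gamma
           = (k%:R - theta1) * (k%:R - theta2) * (k%:R - theta3) / n%:R]).
Proof.
(* A graph without vertices would be vacuously complete. *)
have V_gt0 : (0 < #|V|)%N.
  by case: posnP => // /card0_eq V0; case: e_ncomp => x; have := V0 x; rewrite inE.
split; first split.
- case=> s [uniq_s eig_s] size_s.
  have ks : k%:R \in s by rewrite eig_s (eigenvalue_degree R e_sym e_reg).
  (* Removing [k] leaves at most three eigenvalues, common roots of one cubic. *)
  have [|a [b [c roots]]] := cubic_roots_seq (s := rem k%:R s).
    by rewrite size_rem //; case: (size s) size_s.
  have [|d A3] := @adj_mx_cubic R V e k e_sym e_reg a b c V_gt0 e_conn.
    by move=> t eig_t tk; apply: roots; rewrite mem_rem_uniq // inE tk eig_s.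
  have wscr := cubic_weakly_strongly_regular e_sym e_irr e_reg e_coreg A3.
  by do 3!eexists; exact: wscr.
- case=> alpha [beta [gamma [wer scer]]].
  have A3 := weakly_strongly_regular_cubic e_sym e_irr e_reg wer scer.
  have [s [uniq_s eig_s]] := exists_distinct_eigenvalues R e_sym.
  (* The bound becomes [size s < 5], where [5] is the size of the quartic [('X - k%:R%:P) * q],
     which vanishes at every eigenvalue. *)
  exists s => //; rewrite -ltnS.
  move: A3; set a := _ - _; set b := _ - gamma; set c := _ - _ * #|V|%:R => A3.
  pose q : {poly R} := 'X^3 - a *: 'X^2 - b *: 'X - c%:P.
  have size_q : size q = 4%N := size_cubic a b c.
  have size_p : size (('X - k%:R%:P) * q) = 5%N.
    by rewrite size_monicM ?monicXsubC ?size_XsubC ?size_q // -size_poly_gt0 size_q.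
  rewrite -size_p; apply: max_poly_roots => //; first by rewrite -size_poly_gt0 size_p.
  apply/allP => t; rewrite eig_s => eig_t; rewrite rootM root_XsubC.
  have [//|tk /=] := eqVneq t k%:R.
  rewrite rootE !(hornerD, hornerN, hornerZ, hornerXn, hornerX, hornerC).
  rewrite (eigenvalue_cubic e_reg A3 eig_t tk).
  by apply/eqP; ring.
move=> alpha beta gamma t1 t2 t3 wer scer [_ eig] t1k t21 t32.
have A3 := weakly_strongly_regular_cubic e_sym e_irr e_reg wer scer.
have rowsum := cubic_rowsum e_reg V_gt0 A3.
move: A3 rowsum; set a := _ - mu%:R; set b := _ - gamma; set d := _ + gamma.
set c := _ - _ * #|V|%:R => A3 rowsum.
have root_t t : t \in [:: t1; t2; t3] -> t < k%:R ->
    t ^+ 3 = a * t ^+ 2 + b * t + c.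
  move=> tin tk; apply: (eigenvalue_cubic e_reg A3); last by rewrite lt_eqF.
  by rewrite -eig inE tin orbT.
have t2k := lt_trans t21 t1k; have t3k := lt_trans t32 t2k.
have [||||||aE bE cE] := @cubic_vieta _ a b c t1 t2 t3.
- by apply: root_t; rewrite ?inE ?eqxx.
- by apply: root_t; rewrite ?inE ?eqxx ?orbT.
- by apply: root_t; rewrite ?inE ?eqxx ?orbT.
- by rewrite gt_eqF.
- by rewrite gt_eqF // (lt_trans t32).
- by rewrite gt_eqF.
(* The first two identities are [aE] and [bE]. For the third, [d * n] is the cubic evaluated at [k],
   which factors over its roots [t1], [t2], [t3]. *)
split=> //; rewrite -card_V; apply: (canRL (mulfK _)).
  by rewrite pnatr_eq0 -lt0n.
rewrite -(addKr (a * k%:R ^+ 2 + b * k%:R + c) (d * _)) -rowsum aE bE cE; ring.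
Qed.
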